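(* Let $X$ be well ordered, $\Omega=\{P\}$, $\lambda\in K$, $\mathfrak{S}(X)$ ordered by order $(1)$, and $S=\{P(x)P(y)-P(P(x)y)-P(xP(y))-\lambda P(xy)\mid x,y\in\mathfrak{S}(X)\}$. Then $Irr(S)=\Phi(X)$, and $\Phi(X)$ is a $K$-basis of $K\langle X;P|S\rangle=K\langle X;P\rangle/Id(S)$.
   Context: $K$ is a commutative ring with unit. $S(Y)$ denotes the free semigroup on $Y$. $\mathfrak{S}(X)$ is the set of $\Omega$-words for $\Omega=\{P\}$ unary: $\mathfrak{S}_0=S(X)$, $\mathfrak{S}_n=S(X\cup\{P(u)\mid u\in\mathfrak{S}_{n-1}\})$, $\mathfrak{S}(X)=\bigcup_n\mathfrak{S}_n$. $K\langle X;P\rangle$ is the free $K$-module on $\mathfrak{S}(X)$ with concatenation product and $P$ extended linearly. $\mathfrak{S}^\star(X)$ is the set of $\Omega$-words on $X\cup\{\star\}$ with exactly one $\star$, $u|_s$ the substitution of $s$ for $\star$. $Id(S)$ is the $K$-span of all $u|_s$, $u\in\mathfrak{S}^\star(X)$, $s\in S$. $\bar f$ is the leading word of $f$ w.r.t. the given order, and $Irr(S)=\{w\in\mathfrak{S}(X)\mid w\ne u|_{\bar s}\text{ for all }u\in\mathfrak{S}^\star(X),s\in S\}$. Order (1): with $X^*$ ordered deg-lex, write $u=u_0P(x_1)u_1\cdots P(x_t)u_t$ uniquely ($u_i\in X^*$, $x_k\in\mathfrak{S}(X)$), $wt(u)=(t,P,x_1,\dots,P,x_t,u_0,\dots,u_t)$,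 and $u>v$ iff $wt(u)>wt(v)$ lexicographically (recursively on depth). Rota–Baxter words: for $Y,Z\subseteq\mathfrak{S}(X)$ let $YP(Z)=\{yP(z)\}$ etc. and $\Lambda^P_X(Y,Z)=\bigcup_{r\ge1}(YP(Z))^r\cup\bigcup_{r\ge0}(YP(Z))^rY\cup\bigcup_{r\ge1}(P(Z)Y)^r\cup\bigcup_{r\ge0}(P(Z)Y)^rP(Z)$. Put $\Phi_0=S(X)$, $\Phi_n=\Lambda^P_X(\Phi_0,\Phi_{n-1})$ for $n>0$, and $\Phi(X)=\bigcup_{n\ge0}\Phi_n$. *)

(* Defs.v *)
From HB Require Import structures.
From mathcomp Require Import all_boot all_order all_algebra.
Set Implicit Arguments. Unset Strict Implicit. Unset Printing Implicit Defensive.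
Import Order.TTheory GRing.Theory.

(* Omega-words for Omega = {P} unary, over an alphabet A.              *)
(* A word is a nonempty sequence of letters; a letter is either a      *)
(* generator a : A or P(w) for a word w.  word A = \frak S(A).         *)
Inductive word (A : Type) : Type :=
| wsing : letter A -> word A
| wcons : letter A -> word A -> word A
with letter (A : Type) : Type :=
| LX : A -> letter A
| LP : word A -> letter A.

Arguments wsing {A} l.
Arguments wcons {A} l w.
Arguments LX {A} a.
Arguments LP {A} w.

Scheme word_mut := Induction for word Sort Prop
  with letter_mut := Induction for letter Sort Prop.

Section WordBasics.
Variable A : Type.

Fixpoint wcat (u v : word A) : word A :=
  match u with
  | wsing l => wcons l v
  | wcons l u' => wcons l (wcat u' v)
  end.

Fixpoint letters (u : word A) : seq (letter A) :=
  match u with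
  | wsing l => [:: l]
  | wcons l u' => l :: letters u'
  end.

Fixpoint wsize (u : word A) : nat :=
  match u with
  | wsing l => lsize l
  | wcons l u' => lsize l + wsize u'
  end
with lsize (l : letter A) : nat :=
  match l with
  | LX _ => 1
  | LP w => (wsize w).+1
  end.

Definition pw (z : word A) : word A := wsing (LP z).

End WordBasics.

Section WordEq.
Variable A : eqType.

Fixpoint weqb (u v : word A) : bool :=
  match u, v with
  | wsing l, wsing l' => leqb l l'
  | wcons l u', wcons l' v' => leqb l l' && weqb u' v'
  | _, _ => false
  end
with leqb (l l' : letter A) : bool :=
  match l, l' with
  | LX a, LX b => a == b
  | LP u, LP v => weqb u v
  | _, _ => false
  end.

Lemma weqb_iff : forall u v, weqb u v <-> u = v.
Proof.
apply: (@word_mut A (fun u => forall v, weqb u v <-> u = v)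
                 (fun l => forall l', leqb l l' <-> l = l')).
- move=> l IH [l'|l' v] /=; last by split.
  by split=> [/IH->|[]/IH].
- move=> l IHl u IHu [l'|l' v] /=; first by split.
  split; first by case/andP=> /IHl -> /IHu ->.
  by case=> <- <-; apply/andP; split; [apply/IHl | apply/IHu].
- move=> a [b|w] /=; last by split.
  by split; [move/eqP->|case=>->].
- move=> w IH [b|w'] /=; first by split.
  by split=> [/IH->|[]/IH].
Qed.

Lemma weqbP : Equality.axiom weqb.
Proof. by move=> u v; apply: (iffP idP); move/weqb_iff. Qed.

HB.instance Definition _ := hasDecEq.Build (word A) weqbP.

End WordEq.

Section Order1.
Variables (d : Order.disp_t) (X : orderType d).

(* write u = u_0 P(x_1) u_1 ... P(x_t) u_t : returns ([u_0;...;u_t], [x_1;...;x_t]) *)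
Fixpoint decomp (ls : seq (letter X)) : seq (seq X) * seq (word X) :=
  match ls with
  | [::] => ([:: [::]], [::])
  | LX x :: r =>
      let (segs, args) := decomp r in
      match segs with
      | s :: ss => ((x :: s) :: ss, args)
      | [::] => ([:: [:: x]], args)
      end
  | LP w :: r =>
      let (segs, args) := decomp r in ([::] :: segs, w :: args)
  end.

Definition cmpX (x y : X) : comparison :=
  if (x < y)%O then Lt else if x == y then Eq else Gt.

Fixpoint lexcmp (T : Type) (c : T -> T -> comparison) (s t : seq T) : comparison :=
  match s, t with
  | [::], [::] => Eq
  | [::], _ => Lt
  | _, [::] => Gt
  | a :: s', b :: t' =>
      match c a b with
      | Eq => lexcmp c s' t'
      | r => r
      end
  end.

Definition deglex (s t : seq X) : comparison :=
  match Nat.compare (size s) (size t) with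
  | Eq => lexcmp cmpX s t
  | r => r
  end.

(* comparison of wt(u) = (t, P, x_1, ..., P, x_t, u_0, ..., u_t) and wt(v),
   lexicographically, recursively on the x_i; n is fuel (see word_lt) *)
Fixpoint wcmp (n : nat) (u v : word X) : comparison :=
  match n with
  | 0 => Eq
  | n'.+1 =>
      let (su, au) := decomp (letters u) in
      let (sv, av) := decomp (letters v) in
      match Nat.compare (size au) (size av) with
      | Eq =>
          match lexcmp (wcmp n') au av with
          | Eq => lexcmp deglex su sv
          | r => r
          end
      | r => r
      end
  end.

(* u < v in order (1); the fuel wsize u + wsize v is sufficient for the
   recursion to bottom out on the actual words. *)
Definition word_lt (u v : word X) : bool :=
  if wcmp (wsize u + wsize v) u v is Lt then true else false.

End Order1.

(* K<X;P>: elements are formal K-linear combinations of Omega-words    *)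
(* (finite lists of (coefficient, word)); two lists denote the same     *)
(* element iff they have the same coefficient function [ocoef].         *)
Section Poly.
Local Open Scope ring_scope.
Variables (K : comNzRingType) (d : Order.disp_t) (X : orderType d).

Definition opoly := seq (K * word X).

Definition ocoef (f : opoly) (w : word X) : K := \sum_(e <- f | e.2 == w) e.1.

Definition psub (f g : opoly) : opoly := f ++ [seq (- e.1, e.2) | e <- g].

Definition lead (f : opoly) (w : word X) : Prop :=
  ocoef f w != 0 /\ forall v, ocoef f v != 0 -> v = w \/ word_lt v w.

Definition sRB (lam : K) (x y : word X) : opoly :=
  [:: (1, wcat (pw x) (pw y));
      (-1, pw (wcat (pw x) y));
      (-1, pw (wcat x (pw y)));
      (- lam, pw (wcat x y))].

(* star-words: Omega-words on X \cup {star}, star encoded as None *)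
Fixpoint starcount (u : word (option X)) : nat :=
  match u with
  | wsing l => lstarcount l
  | wcons l u' => lstarcount l + starcount u'
  end
with lstarcount (l : letter (option X)) : nat :=
  match l with
  | LX None => 1
  | LX (Some _) => 0
  | LP w => starcount w
  end.

Fixpoint subst (s : word X) (u : word (option X)) : word X :=
  match u with
  | wsing l => lsubst s l
  | wcons l u' => wcat (lsubst s l) (subst s u')
  end
with lsubst (s : word X) (l : letter (option X)) : word X :=
  match l with
  | LX None => s
  | LX (Some x) => wsing (LX x)
  | LP w => wsing (LP (subst s w))
  end.

Definition substp (u : word (option X)) (f : opoly) : opoly :=
  [seq (e.1, subst e.2 u) | e <- f].

Definition inId (lam : K) (f : opoly) : Prop :=
  exists l : seq (K * (word (option X) * (word X * word X))),
    (forall e, e \in l -> starcount e.2.1 = 1) /\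
    forall w, ocoef f w = \sum_(e <- l) e.1 * ocoef (substp e.2.1 (sRB lam e.2.2.1 e.2.2.2)) w.

Definition Irr (lam : K) (w : word X) : Prop :=
  forall (u : word (option X)) (x y v : word X),
    starcount u = 1 -> lead (sRB lam x y) v -> w <> subst v u.

End Poly.

Section RBWords.
Variable A : Type.

Definition isX (w : word A) : Prop :=
  all (fun l => if l is LX _ then true else false) (letters w).

Definition YPZ (Y Z : word A -> Prop) (w : word A) : Prop :=
  exists y z, Y y /\ Z z /\ w = wcat y (pw z).
Definition PZY (Y Z : word A -> Prop) (w : word A) : Prop :=
  exists z y, Z z /\ Y y /\ w = wcat (pw z) y.
Definition PZ (Z : word A -> Prop) (w : word A) : Prop :=
  exists z, Z z /\ w = pw z.

(* prodset T r U = T^r U  (so T^0 U = U, and T^(r+1) = prodset T r T) *)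
Fixpoint prodset (T : word A -> Prop) (r : nat) (U : word A -> Prop) : word A -> Prop :=
  match r with
  | 0 => U
  | r'.+1 => fun w => exists a b, T a /\ prodset T r' U b /\ w = wcat a b
  end.

Definition LambdaP (Y Z : word A -> Prop) (w : word A) : Prop :=
     (exists r, prodset (YPZ Y Z) r (YPZ Y Z) w)   (* (YP(Z))^(r+1), r+1 >= 1 *)
  \/ (exists r, prodset (YPZ Y Z) r Y w)
  \/ (exists r, prodset (PZY Y Z) r (PZY Y Z) w)   (* (P(Z)Y)^(r+1), r+1 >= 1 *)
  \/ (exists r, prodset (PZY Y Z) r (PZ Z) w).

Fixpoint Phin (n : nat) : word A -> Prop :=
  match n with
  | 0 => isX
  | n'.+1 => LambdaP isX (Phin n')
  end.

Definition Phi (w : word A) : Prop := exists n, Phin n w.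

End RBWords.

(* Main.v *)
Require Import Defs.
From HB Require Import structures.
From mathcomp Require Import all_boot all_order all_algebra.
From mathcomp Require Import zify.
From mathcomp.multinomials Require Import freeg.
Set Implicit Arguments. Unset Strict Implicit. Unset Printing Implicit Defensive.
Import GRing.Theory.
Local Open Scope ring_scope.

(** Both [Irr] and [Phi] consist of the words in which no two letters [P(_)] are
    adjacent, at any depth.  These words span the quotient because the rewriting
    rule [P(x)P(y) -> P(P(x)y) + P(xP(y)) + lam P(xy)] strictly decreases a
    multiplicative weight.

    For independence, the free module on all words carries a second product, in
    which only the last letter of the left factor and the first letter of the
    right one interact: they are concatenated unless they are [P(x)] and [P(y)],
    in which case the Rota-Baxter identity dictates, recursively, what replaces
    them.  This product is associative, so it makes the free module a Rota-Baxter
    algebra; evaluating words in that algebra kills the ideal and fixes every word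
    of [Phi]. *)

(** * Words *)

Section WordChoice.
Variable A : choiceType.

Fixpoint word_encode (u : word A) : GenTree.tree A :=
  match u with
  | wsing l => GenTree.Node 0 [:: letter_encode l]
  | wcons l u' => GenTree.Node 1 [:: letter_encode l; word_encode u']
  end
with letter_encode (l : letter A) : GenTree.tree A :=
  match l with
  | LX a => GenTree.Leaf a
  | LP w => GenTree.Node 0 [:: word_encode w]
  end.

Fixpoint word_decode (t : GenTree.tree A) : option (word A) :=
  match t with
  | GenTree.Node _ [:: t1] => omap wsing (letter_decode t1)
  | GenTree.Node _ [:: t1; t2] =>
      obind (fun l => omap (wcons l) (word_decode t2)) (letter_decode t1)
  | _ => None
  end
with letter_decode (t : GenTree.tree A) : option (letter A) :=
  match t with
  | GenTree.Leaf a => Some (LX a)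
  | GenTree.Node _ [:: t1] => omap LP (word_decode t1)
  | _ => None
  end.

Lemma word_encodeK : pcancel word_encode word_decode.
Proof.
apply: (@word_mut A (fun u => word_decode (word_encode u) = Some u)
                    (fun l => letter_decode (letter_encode l) = Some l)) => //=.
- by move=> l ->.
- by move=> l -> u ->.
- by move=> w ->.
Qed.

HB.instance Definition _ := PCanHasChoice word_encodeK.

End WordChoice.

Section WordTheory.
Variable A : Type.
Implicit Types (u v w z : word A) (l : letter A).

Lemma wcatA : associative (@wcat A).
Proof. by move=> u v w; elim: u => //= l u ->. Qed.

Lemma lsize_gt0 l : (0 < lsize l)%N. Proof. by case: l. Qed.

Lemma wsize_gt0 u : (0 < wsize u)%N.
Proof. by case: u => [l|l u] /=; rewrite ?addn_gt0 lsize_gt0. Qed.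

Definition is_P l : bool := if l is LP _ then true else false.

Definition word_head u : letter A :=
  match u with wsing l => l | wcons l _ => l end.

Fixpoint word_last u : letter A :=
  match u with wsing l => l | wcons _ u' => word_last u' end.

Definition PP_junction u v : bool := is_P (word_last u) && is_P (word_head v).

Fixpoint rb_word u : bool :=
  match u with
  | wsing l => rb_letter l
  | wcons l u' => [&& rb_letter l, rb_word u' & ~~ PP_junction (wsing l) u']
  end
with rb_letter l : bool := if l is LP w then rb_word w else true.

Lemma word_head_cat u v : word_head (wcat u v) = word_head u.
Proof. by case: u. Qed.

Lemma rb_word_cat u v :
  rb_word (wcat u v) = [&& rb_word u, rb_word v & ~~ PP_junction u v].
Proof.
rewrite /PP_junction; elim: u => //= l u ->; rewrite /PP_junction word_head_cat /=.
by rewrite -!andbA; do !bool_congr; rewrite andbC -!andbA.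
Qed.

Lemma isX_rb_word w :
  isX w -> [/\ rb_word w, ~~ is_P (word_head w) & ~~ is_P (word_last w)].
Proof. by rewrite /isX; elim: w => [[]|[a|z] w IH] //= /IH[-> ? ->]. Qed.

End WordTheory.

(** * Rota-Baxter words *)

Section RotaBaxterWords.
Variable A : Type.
Implicit Types (B C T U Y Z : word A -> Prop) (u w z : word A).

Definition wcat_set B C w : Prop := exists b c, B b /\ C c /\ w = wcat b c.

Inductive alternating B C : word A -> Prop :=
| alternating_one b : B b -> alternating B C b
| alternating_cat b w : B b -> alternating C B w -> alternating B C (wcat b w).

Lemma alternating_catl B C x w :
  (forall b, B b -> B (wcat x b)) -> alternating B C w -> alternating B C (wcat x w).
Proof.
move=> Bx [b Bb|b v Bb altv]; first exact/alternating_one/Bx.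
by rewrite wcatA; apply: alternating_cat => //; apply: Bx.
Qed.

Lemma prodset_alternating B C T U r w :
  (forall t, T t -> wcat_set B C t) -> (forall t, U t -> alternating B C t) ->
  prodset T r U w -> alternating B C w.
Proof.
move=> TBC Ualt; elim: r w => [|r IH] w /=; first exact: Ualt.
move=> [_ [v [/TBC[b [c [Bb [Cc ->]]]] [/IH altv ->]]]].
by rewrite -wcatA; apply: alternating_cat => //; apply: alternating_cat.
Qed.

Definition some_prodset T U w : Prop :=
  (exists r, prodset T r T w) \/ (exists r, prodset T r U w).

Lemma some_prodset_cat T U t w :
  T t -> some_prodset T U w -> some_prodset T U (wcat t w).
Proof. by move=> Tt [] [r prodw]; [left | right]; exists r.+1, t, w. Qed.

Lemma alternating_some_prodset B C T w :
  (forall t, wcat_set B C t -> T t) -> alternating B C w -> some_prodset T B w.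
Proof.
(* Removing a factor exchanges [B] and [C]: treat [w] and all [c w] together. *)
move=> BCT altw.
suff: (forall T, (forall t, wcat_set B C t -> T t) -> some_prodset T B w) /\
    (forall T c, (forall t, wcat_set C B t -> T t) -> C c ->
       some_prodset T C (wcat c w)) by case=> prod_w _; apply: prod_w.
elim: altw => {T BCT} {}B {}C b => [Bb|{}w Bb _ [prod_w prod_bw]]; split=> T.
- by right; exists 0.
- by move=> c CBT Cc; left; exists 0; apply: CBT; exists c, b.
- by move=> BCT; apply: prod_bw.
- move=> c CBT Cc; rewrite wcatA; apply: some_prodset_cat (prod_w T CBT).
  by apply: CBT; exists c, b.
Qed.

Lemma alternatingP B C T w :
  (forall t, T t <-> wcat_set B C t) -> alternating B C w <-> some_prodset T B w.
Proof.
move=> TE; split; first by apply: alternating_some_prodset => t /TE.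
case=> -[r]; apply: (prodset_alternating (fun t => (TE t).1)) => t.
  by move=> /TE[b [c [Bb [Cc ->]]]]; exact/alternating_cat/alternating_one.
exact: alternating_one.
Qed.

Lemma LambdaP_alternating Y Z w :
  LambdaP Y Z w <-> alternating Y (PZ Z) w \/ alternating (PZ Z) Y w.
Proof.
have YPZE v : YPZ Y Z v <-> wcat_set Y (PZ Z) v.
  split=> [[y [z [Yy [Zz ->]]]]|[y [_ [Yy [[z [Zz ->]] ->]]]]]; last by exists y, z.
  by exists y, (pw z); split=> //; split=> //; exists z.
have PZYE v : PZY Y Z v <-> wcat_set (PZ Z) Y v.
  split=> [[z [y [Zz [Yy ->]]]]|[_ [y [[z [Zz ->]] [Yy ->]]]]]; last by exists z, y.
  by exists (pw z), y; split=> //; exists z.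
by rewrite (alternatingP _ YPZE) (alternatingP _ PZYE) /LambdaP /some_prodset; tauto.
Qed.

Lemma alternating_rb_word B C w :
  (forall b, B b -> rb_word b) -> (forall c, C c -> rb_word c) ->
  (forall b c, B b -> C c -> ~~ PP_junction b c && ~~ PP_junction c b) ->
  alternating B C w -> rb_word w /\ exists2 b, B b & word_head w = word_head b.
Proof.
move=> rbB rbC sepBC altw; elim: altw rbB rbC sepBC => {B C w}.
  by move=> B C b Bb rbB _ _; split; [apply: rbB | exists b].
move=> B C b w Bb _ IH rbB rbC sepBC.
have sepCB c b' : C c -> B b' -> ~~ PP_junction c b' && ~~ PP_junction b' c.
  by move=> Cc Bb'; rewrite andbC sepBC.
have [rbw [c Cc wc]] := IH rbC rbB sepCB.
split; last by exists b => //; rewrite word_head_cat.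
by rewrite rb_word_cat rbB //= rbw /PP_junction wc; case/andP: (sepBC b c Bb Cc).
Qed.

Lemma Phin_rb_word n w : Phin n w -> rb_word w.
Proof.
elim: n w => [|n IH] w; first by case/isX_rb_word.
have rbX (y : word A) : isX y -> rb_word y by case/isX_rb_word.
have rbP z : PZ (Phin n) z -> rb_word z by case=> v [/IH rbv ->].
have sepXP y z : isX y -> PZ (Phin n) z -> ~~ PP_junction y z && ~~ PP_junction z y.
  move=> /isX_rb_word[_ y_head y_last] [v [_ ->]].
  by rewrite /PP_junction /= andbT y_last.
case/LambdaP_alternating => altw.
  by case: (alternating_rb_word rbX rbP sepXP altw).
by case: (alternating_rb_word rbP rbX _ altw) => // z y Pz Xy; rewrite andbC sepXP.
Qed.

Lemma rb_word_alternating n Z u :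
  (forall z, (wsize z <= n)%N -> rb_word z -> Z z) ->
  (wsize u <= n.+1)%N -> rb_word u ->
  if is_P (word_head u) then alternating (PZ Z) (@isX A) u
  else alternating (@isX A) (PZ Z) u.
Proof.
move=> smallZ.
have PZ_LP z : (wsize z <= n)%N -> rb_word z -> PZ Z (wsing (LP z)).
  by move=> le_z rbz; exists z; split=> //; apply: smallZ.
elim: u => [[a|z]|[a|z] u IH] /=.
- by move=> _ _; apply: alternating_one.
- by move=> le_z rbz; apply/alternating_one/PZ_LP.
- move=> le_u /andP[rbu _]; have {IH} := IH (ltnW le_u) rbu.
  case: ifP => _ altu; first exact: (alternating_cat (b := wsing (LX a))).
  exact: (alternating_catl (x := wsing (LX a))).
- move=> le_zu /and3P[rbz rbu /negbTE nPu]; rewrite [is_P _]nPu in IH.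
  apply: (alternating_cat (b := wsing (LP z))); first by apply: PZ_LP => //; lia.
  by apply: IH => //; lia.
Qed.

Lemma rb_word_Phin n w : (wsize w <= n)%N -> rb_word w -> Phin n w.
Proof.
elim: n w => [|n IH] w le_w; first by have := wsize_gt0 w; lia.
move/(rb_word_alternating IH le_w).
by rewrite /= LambdaP_alternating; case: ifP => _; [right | left].
Qed.

Lemma Phi_rb_word w : Phi w <-> rb_word w.
Proof.
split; first by case=> n /Phin_rb_word.
by move=> rbw; exists (wsize w); apply: rb_word_Phin.
Qed.

End RotaBaxterWords.

(** * Substitution and irreducible words *)

Section Evaluation.
Variables (V : Type) (mul : V -> V -> V) (op : V -> V).

Fixpoint weval (A : Type) (h : A -> V) (u : word A) : V :=
  match u with
  | wsing l => leval h l
  | wcons l u' => mul (leval h l) (weval h u')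
  end
with leval (A : Type) (h : A -> V) (l : letter A) : V :=
  match l with
  | LX a => h a
  | LP w => op (weval h w)
  end.

Hypothesis mulA : associative mul.

Lemma weval_cat (A : Type) (h : A -> V) u v :
  weval h (wcat u v) = mul (weval h u) (weval h v).
Proof. by elim: u => //= l u ->; rewrite mulA. Qed.

Variables (d : Order.disp_t) (X : orderType d) (h : X -> V).
Implicit Types (s w : word X) (u v : word (option X)).

Lemma weval_subst s u :
  weval h (subst s u) = weval (oapp h (weval h s)) u.
Proof.
apply: (@word_mut (option X)
  (fun u => weval h (subst s u) = weval (oapp h (weval h s)) u)
  (fun l => weval h (lsubst s l) = leval (oapp h (weval h s)) l)) => //=.
- by move=> l IHl v IHv; rewrite weval_cat IHl IHv.
- by case.
- by move=> w ->.
Qed.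

Lemma weval_starless m m' u :
  starcount u = 0%N -> weval (oapp h m) u = weval (oapp h m') u.
Proof.
apply: (@word_mut (option X)
  (fun u => starcount u = 0%N -> weval (oapp h m) u = weval (oapp h m') u)
  (fun l => lstarcount l = 0%N -> leval (oapp h m) l = leval (oapp h m') l)) => //=.
- by move=> l IHl v IHv /eqP; rewrite addn_eq0 => /andP[/eqP/IHl-> /eqP/IHv->].
- by case.
- by move=> w IH /IH->.
Qed.

Lemma leval_starless m m' (l : letter (option X)) :
  lstarcount l = 0%N -> leval (oapp h m) l = leval (oapp h m') l.
Proof. exact: (@weval_starless m m' (wsing l)). Qed.

End Evaluation.

Section Substitution.
Variables (d : Order.disp_t) (X : orderType d).
Implicit Types (s w x y : word X) (u v : word (option X)).

Fixpoint wembed w : word (option X) :=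
  match w with
  | wsing l => wsing (lembed l)
  | wcons l w' => wcons (lembed l) (wembed w')
  end
with lembed (l : letter X) : letter (option X) :=
  match l with
  | LX a => LX (Some a)
  | LP w => LP (wembed w)
  end.

Lemma starcount_embed w : starcount (wembed w) = 0%N.
Proof.
by apply: (@word_mut X (fun w => starcount (wembed w) = 0%N)
                    (fun l => lstarcount (lembed l) = 0%N)) => //= l -> w' ->.
Qed.

Lemma subst_embed s w : subst s (wembed w) = w.
Proof.
apply: (@word_mut X (fun w => subst s (wembed w) = w)
                    (fun l => lsubst s (lembed l) = wsing l)) => //=.
- by move=> l -> w' ->.
- by move=> w' ->.
Qed.

Lemma starcount_cat u v : starcount (wcat u v) = (starcount u + starcount v)%N.
Proof. by elim: u => //= l u ->; rewrite addnA. Qed.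

Lemma subst_cat s u v : subst s (wcat u v) = wcat (subst s u) (subst s v).
Proof. by elim: u => //= l u ->; rewrite wcatA. Qed.

Definition PP x y : word X := wcat (pw x) (pw y).

Definition has_PP w : Prop :=
  exists u x y, starcount u = 1%N /\ w = subst (PP x y) u.

Lemma has_PP_catl w w' : has_PP w -> has_PP (wcat w w').
Proof.
move=> [u [x [y [u1 ->]]]]; exists (wcat u (wembed w')), x, y.
by rewrite starcount_cat subst_cat starcount_embed subst_embed u1.
Qed.

Lemma has_PP_catr w w' : has_PP w' -> has_PP (wcat w w').
Proof.
move=> [u [x [y [u1 ->]]]]; exists (wcat (wembed w) u), x, y.
by rewrite starcount_cat subst_cat starcount_embed subst_embed u1.
Qed.

Lemma has_PP_pw w : has_PP w -> has_PP (pw w).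
Proof. by move=> [u [x [y [u1 ->]]]]; exists (pw u), x, y. Qed.

Lemma has_PP_PP x y : has_PP (PP x y).
Proof. by exists (wsing (LX None)), x, y. Qed.

Lemma not_rb_word_has_PP w : ~~ rb_word w -> has_PP w.
Proof.
apply: (@word_mut X (fun w => ~~ rb_word w -> has_PP w)
                    (fun l => ~~ rb_letter l -> has_PP (wsing l))) => //=.
- move=> l IHl u IHu.
  case: (boolP (rb_letter l)) => [_|nrb_l _]; last exact: (has_PP_catl u (IHl _)).
  case: (boolP (rb_word u)) => [_|nrb_u _]; last exact: (has_PP_catr (wsing l) (IHu _)).
  case: l {IHl} => [//|x]; case: u {IHu} => [[//|y]|[//|y] u] _.
    exact: has_PP_PP.
  exact: (has_PP_catl u (has_PP_PP x y)).
- by move=> w' IH /IH/has_PP_pw.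
Qed.

Lemma rb_word_subst s u : (0 < starcount u)%N -> rb_word (subst s u) -> rb_word s.
Proof.
apply: (@word_mut (option X)
  (fun u => (0 < starcount u)%N -> rb_word (subst s u) -> rb_word s)
  (fun l => (0 < lstarcount l)%N -> rb_word (lsubst s l) -> rb_word s)) => //=.
- move=> l IHl v IHv; rewrite addn_gt0 rb_word_cat => star /and3P[rbl rbv _].
  by case/orP: star => [/IHl|/IHv]; apply.
- by case.
Qed.

Lemma has_PP_not_rb_word w : has_PP w -> ~~ rb_word w.
Proof.
move=> [u [x [y [u1 ->]]]]; apply/negP => /rb_word_subst.
by rewrite u1 rb_word_cat /= !andbF => /(_ isT).
Qed.

End Substitution.

Section Irreducible.
Variables (K : comNzRingType) (d : Order.disp_t) (X : orderType d) (lam : K).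
Implicit Types w x y z : word X.

Lemma word_lt_pw_PP x y z : word_lt (pw z) (PP x y).
Proof. by []. Qed.

Lemma word_lt_PP_pw x y z : word_lt (PP x y) (pw z) = false.
Proof. by []. Qed.

Lemma ocoef_sRB_PP x y : ocoef (sRB lam x y) (PP x y) = 1.
Proof. by rewrite /ocoef /sRB !big_cons big_nil /= eqxx addr0. Qed.

Lemma ocoef_sRB_neq0 x y v :
  ocoef (sRB lam x y) v != 0 -> v = PP x y \/ exists z, v = pw z.
Proof.
rewrite /ocoef /sRB !big_cons big_nil /=.
case: ifP => [/eqP<-|_]; first by left.
by do 3![case: ifP => [/eqP<-|_]; first by right; eexists]; rewrite eqxx.
Qed.

Lemma lead_sRB x y v : lead (sRB lam x y) v <-> v = PP x y.
Proof.
have PP_neq0 : ocoef (sRB lam x y) (PP x y) != 0 by rewrite ocoef_sRB_PP oner_eq0.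
split=> [[/ocoef_sRB_neq0[//|[z ->]] /(_ _ PP_neq0)[//|]]|->].
  by rewrite word_lt_PP_pw.
split=> // w /ocoef_sRB_neq0[->|[z ->]]; first by left.
by right; apply: word_lt_pw_PP.
Qed.

Lemma Irr_rb_word w : Irr lam w <-> rb_word w.
Proof.
split=> [irr|rbw u x y v u1 /lead_sRB-> eq_w].
  apply: contraT => /not_rb_word_has_PP[u [x [y [u1 eq_w]]]].
  by case: (irr u x y (PP x y)) => //; apply/lead_sRB.
have /has_PP_not_rb_word/negP[//] : has_PP w by exists u, x, y.
Qed.

End Irreducible.

(** * Free modules *)

Section Submodule.
Variables (K : nzRingType) (V : lmodType K).
Implicit Types (U W : V -> Prop).

Definition submodule U : Prop :=
  U 0 /\ forall c u v, U u -> U v -> U (c *: u + v).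

Lemma submoduleD U u v : submodule U -> U u -> U v -> U (u + v).
Proof. by move=> [_ UP] Uu Uv; rewrite -[u]scale1r; apply: UP. Qed.

Lemma submoduleZ U c v : submodule U -> U v -> U (c *: v).
Proof. by move=> [U0 UP] Uv; rewrite -[_ *: _]addr0; apply: UP. Qed.

Lemma equalizer_submodule (M : lmodType K) (p q : {linear V -> M}) :
  submodule (fun v => p v = q v).
Proof. by split=> [|c u v eq_u eq_v]; rewrite ?linear0 // !linearP eq_u eq_v. Qed.

Definition sum_pred U W v : Prop := exists u w, [/\ U u, W w & v = u + w].

Lemma sum_pred_submodule U W :
  submodule U -> submodule W -> submodule (sum_pred U W).
Proof.
move=> [U0 UP] [W0 WP]; split; first by exists 0, 0; rewrite addr0.
move=> c _ _ [u [w [Uu Ww ->]]] [u' [w' [Uu' Ww' ->]]].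
exists (c *: u + u'), (c *: w + w').
by split; [apply: UP | apply: WP | rewrite scalerDr addrACA].
Qed.

Lemma sum_predl U W u : submodule W -> U u -> sum_pred U W u.
Proof. by move=> [W0 _] Uu; exists u, 0; rewrite addr0. Qed.

Lemma sum_predr U W w : submodule U -> W w -> sum_pred U W w.
Proof. by move=> [U0 _] Ww; exists 0, w; rewrite add0r. Qed.

Variables (I : eqType) (P : I -> Prop) (F : I -> V).

Definition spanned v : Prop := exists s : seq (K * I),
  (forall e, e \in s -> P e.2) /\ v = \sum_(e <- s) e.1 *: F e.2.

Lemma spanned_gen i : P i -> spanned (F i).
Proof.
move=> Pi; exists [:: (1, i)]; rewrite big_seq1 scale1r; split=> // e.
by rewrite inE => /eqP->.
Qed.

Lemma spanned_submodule : submodule spanned.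
Proof.
split; first by exists [::]; rewrite big_nil.
move=> c _ _ [s [Ps ->]] [t [Pt ->]].
exists ([seq (c * e.1, e.2) | e <- s] ++ t); split=> [e|].
  by rewrite mem_cat => /orP[/mapP[e' /Ps Pe' ->]|/Pt].
rewrite big_cat big_map scaler_sumr; congr (_ + _).
by apply: eq_bigr => e _; rewrite scalerA.
Qed.

Lemma spanned_min U v :
  submodule U -> (forall i, P i -> U (F i)) -> spanned v -> U v.
Proof.
move=> [U0 UP] UF [s [Ps ->]]; rewrite big_seq.
by elim/big_rec: _ => // e u /Ps/UF Ue; apply: UP.
Qed.

Lemma spanned_linear_ext (M : lmodType K) (p q : {linear V -> M}) v :
  (forall i, P i -> p (F i) = q (F i)) -> spanned v -> p v = q v.
Proof. by move=> eqF; apply: (spanned_min (equalizer_submodule p q)). Qed.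

End Submodule.

Section FreeModule.
Variables (K : nzRingType) (T : choiceType).
Local Notation M := {freeg T / K}.

Lemma freegZU (c : K) (k : T) : << c *g k >> = c *: << k >> :> M.
Proof. by apply/eqP/freeg_eqP => k'; rewrite coeffZ !coeffU mul1r. Qed.

Lemma freeg_sum (s : seq (K * T)) : [freeg s] = \sum_(e <- s) e.1 *: << e.2 >> :> M.
Proof.
elim: s => [|[c k] s IH]; first by rewrite big_nil freeg_nil.
by rewrite -cat1s freeg_cat IH big_cons freegZU.
Qed.

Lemma spanned_freeg (D : M) : spanned (fun=> True) (fun k => << k >>) D.
Proof. by exists (repr D); split=> //; rewrite -freeg_sum freeg_repr. Qed.

Lemma freeg_linear_ext (V : lmodType K) (p q : {linear M -> V}) :
  (forall k, p << k >> = q << k >>) -> p =1 q.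
Proof. by move=> eq_pq D; apply: spanned_linear_ext (spanned_freeg D). Qed.

Lemma fglift_is_linear (V : lmodType K) (h : T -> V) : linear (fglift h).
Proof.
move=> c D E; rewrite -[D]freeg_repr -[E]freeg_repr.
set s : seq _ := repr D; set t : seq _ := repr E.
have -> : c *: [freeg s] + [freeg t] = [freeg [seq (c * e.1, e.2) | e <- s] ++ t] :> M.
  rewrite freeg_cat; congr (_ + _); rewrite !freeg_sum big_map scaler_sumr.
  by apply: eq_bigr => e _; rewrite scalerA.
rewrite !fglift_Freeg prelift_cat /prelift big_map scaler_sumr; congr (_ + _).
by apply: eq_bigr => e _; rewrite scalerA.
Qed.

HB.instance Definition _ (V : lmodType K) (h : T -> V) :=
  GRing.isLinear.Build K M V _ (fglift h) (fglift_is_linear h).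

Lemma fgliftU (V : lmodType K) (h : T -> V) k : fglift h << k >> = h k.
Proof. by rewrite liftU scale1r. Qed.

End FreeModule.

Section BilinearExtension.
Variables (K : comNzRingType) (S T : choiceType) (V : lmodType K).
Variable b : S -> T -> V.

Definition bilift (f : {freeg S / K}) (g : {freeg T / K}) : V :=
  fglift (fun s => fglift (b s) g) f.

Lemma bilift_is_bilinear : bilinear_for *:%R *:%R bilift.
Proof.
split=> [g|f] c x y; rewrite /bilift; first exact: linearP.
rewrite -[f]freeg_repr !fglift_Freeg /prelift /= scaler_sumr -big_split.
by apply: eq_bigr => e _; rewrite linearP scalerDr !scalerA mulrC.
Qed.

HB.instance Definition _ :=
  bilinear_isBilinear.Build K {freeg S / K} {freeg T / K} V *:%R *:%R bilift
    bilift_is_bilinear.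

Lemma biliftU s t : bilift << s >> << t >> = b s t.
Proof. by rewrite /bilift !fgliftU. Qed.

End BilinearExtension.

Lemma freeg_mulA_ext (K : comNzRingType) (T : choiceType)
    (m1 m2 m3 m4 : {bilinear {freeg T / K} -> {freeg T / K} -> {freeg T / K}}) :
  (forall u v w, m1 (m2 << u >> << v >>) << w >> = m3 << u >> (m4 << v >> << w >>)) ->
  forall f g h, m1 (m2 f g) h = m3 f (m4 g h).
Proof.
move=> eqU f g h.
apply: (freeg_linear_ext (p := applyr m1 h \o applyr m2 g)
                         (q := applyr m3 (m4 g h))) => u /=.
apply: (freeg_linear_ext (p := applyr m1 h \o m2 << u >>)
                         (q := m3 << u >> \o applyr m4 h)) => v /=.
apply: (freeg_linear_ext (p := m1 (m2 << u >> << v >>))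
                         (q := m3 << u >> \o m4 << v >>)) => w /=.
exact: eqU.
Qed.

(** * Rota-Baxter algebras *)

Section RotaBaxter.
Variables (K : comNzRingType) (V : lmodType K) (lam : K).
Variables (mul : {bilinear V -> V -> V}) (P : {linear V -> V}).
Local Notation "x ** y" := (mul x y) (at level 40, left associativity).

Definition rota_baxter : Prop :=
  forall f g, P f ** P g = P (P f ** g + f ** P g + lam *: (f ** g)).

Definition mulA_at f g h : Prop := f ** g ** h = f ** (g ** h).

Hypothesis P_rota_baxter : rota_baxter.

Lemma rota_baxter_mul3l f g h :
  P f ** P g ** P h
  = P (P f ** P g ** h + P f ** g ** P h + f ** P g ** P h
       + lam *: (f ** g ** P h + P f ** g ** h + f ** P g ** h)
       + lam ^+ 2 *: (f ** g ** h)).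
Proof.
have := P_rota_baxter f g; set s := (X in P X) => PsE.
rewrite {1}PsE P_rota_baxter -PsE; congr (P _).
by rewrite /s !linearDl !linearZl /= !scalerDr !scalerA -expr2 !addrA.
Qed.

Lemma rota_baxter_mul3r f g h :
  P f ** (P g ** P h)
  = P (P f ** (P g ** h) + P f ** (g ** P h) + f ** (P g ** P h)
       + lam *: (f ** (g ** P h) + P f ** (g ** h) + f ** (P g ** h))
       + lam ^+ 2 *: (f ** (g ** h))).
Proof.
have := P_rota_baxter g h; set s := (X in P X) => PsE.
rewrite {1}PsE P_rota_baxter -PsE; congr (P _).
rewrite /s !linearDr !linearZr /= !scalerDr !scalerA -expr2.
by rewrite [LHS](AC (3*1*3) (1*2*4*(6*3*5)*7)).
Qed.

Lemma rota_baxter_mulA f g h :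
  mulA_at (P f) (P g) h -> mulA_at (P f) g (P h) -> mulA_at f (P g) (P h) ->
  mulA_at f g (P h) -> mulA_at (P f) g h -> mulA_at f (P g) h -> mulA_at f g h ->
  mulA_at (P f) (P g) (P h).
Proof.
rewrite /mulA_at rota_baxter_mul3l rota_baxter_mul3r.
by move=> -> -> -> -> -> -> ->.
Qed.

Hypothesis mulA : associative mul.
Variables (d : Order.disp_t) (X : orderType d) (h : X -> V).
Implicit Types (u : word (option X)) (x y : word X).

Lemma weval_linear u : starcount u = 1%N ->
  exists phi : {linear V -> V}, (fun m => weval mul P (oapp h m) u) =1 phi.
Proof.
apply: (@word_mut (option X)
  (fun u => starcount u = 1%N ->
     exists phi : {linear V -> V}, (fun m => weval mul P (oapp h m) u) =1 phi)
  (fun l => lstarcount l = 1%N ->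
     exists phi : {linear V -> V}, (fun m => leval mul P (oapp h m) l) =1 phi)) => //=.
- move=> l IHl v IHv /eqP; rewrite addn_eq1 => /orP[] /andP[/eqP star_l /eqP star_v].
    have [phi phiE] := IHl star_l.
    exists (applyr mul (weval mul P (oapp h 0) v) \o phi) => m /=.
    by rewrite -phiE (weval_starless _ _ _ m 0).
  have [phi phiE] := IHv star_v.
  exists (mul (leval mul P (oapp h 0) l) \o phi) => m /=.
  by rewrite -phiE (leval_starless _ _ _ m 0).
- by case=> // _; exists idfun.
- by move=> w IH /IH[phi phiE]; exists (P \o phi) => m /=; rewrite -phiE.
Qed.

Lemma prelift_weval_sRB x y : prelift (weval mul P h) (sRB lam x y) = 0.
Proof.
rewrite /prelift /sRB !big_cons big_nil /= !(weval_cat _ mulA) /=.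
rewrite P_rota_baxter !linearD linearZ /=.
by rewrite !scale1r !scaleN1r scaleNr addr0 -!opprD !addrA subrr.
Qed.

Lemma prelift_weval_substp u x y : starcount u = 1%N ->
  prelift (weval mul P h) (substp u (sRB lam x y)) = 0.
Proof.
case/weval_linear=> phi phiE; rewrite -[RHS](linear0 phi) -(prelift_weval_sRB x y).
rewrite /prelift /substp big_map linear_sum; apply: eq_bigr => e _.
by rewrite linearZ /= -phiE (weval_subst _ mulA).
Qed.

End RotaBaxter.

(** * The free Rota-Baxter product *)

Section RotaBaxterProduct.
Variables (K : comNzRingType) (X : choiceType) (lam : K).
Local Notation M := {freeg (word X) / K}.
Implicit Types (u v w x y z : word X) (l : letter X) (f g h : M).

Definition fgcat : {bilinear M -> M -> M} := bilift (fun u v => << wcat u v >>).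
Definition fgP : {linear M -> M} := fglift (fun w => << pw w >>).

Lemma fgcatU u v : fgcat << u >> << v >> = << wcat u v >>.
Proof. exact: biliftU. Qed.

Lemma fgPU u : fgP << u >> = << pw u >>.
Proof. exact: fgliftU. Qed.

Lemma fgcatA : associative fgcat.
Proof.
by move=> f g h; apply/esym/freeg_mulA_ext => u v w; rewrite !fgcatU wcatA.
Qed.

(* The product [P(x) v]; [mulx] stands for left multiplication by [x], which makes
   the recursion on the second factor independent of the one on the first. *)
Fixpoint Pmul x (mulx : word X -> M) v : M :=
  match v with
  | wsing l => Pmul_letter x mulx l
  | wcons l v' => fgcat (Pmul_letter x mulx l) << v' >>
  end
with Pmul_letter x (mulx : word X -> M) l : M :=
  match l with
  | LX b => << wcons (LP x) (wsing (LX b)) >>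
  | LP y => fgP (Pmul x mulx y + mulx (pw y) + lam *: mulx y)
  end.

Fixpoint wmul u : word X -> M :=
  match u with
  | wsing l => lmul l
  | wcons l u' => fun v => fgcat << wsing l >> (wmul u' v)
  end
with lmul l : word X -> M :=
  match l with
  | LX a => fun v => << wcons (LX a) v >>
  | LP x => Pmul x (wmul x)
  end.

Definition rbmul : {bilinear M -> M -> M} := bilift wmul.

Lemma rbmulU u v : rbmul << u >> << v >> = wmul u v.
Proof. exact: biliftU. Qed.

Lemma wmul_catl u v w : wmul (wcat u v) w = fgcat << u >> (wmul v w).
Proof. by elim: u => //= l u ->; rewrite fgcatA fgcatU. Qed.

Lemma wmul_catr u v w : wmul u (wcat v w) = fgcat (wmul u v) << w >>.
Proof.
elim: u => [[a|x]|l u IH] /=; first by rewrite fgcatU.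
  by case: v => [l|l v] //=; rewrite -fgcatA fgcatU.
by rewrite IH fgcatA.
Qed.

Lemma wmul_noPP u v : ~~ PP_junction u v -> wmul u v = << wcat u v >>.
Proof.
elim: u => [[a|x]|l u IH] //= nPP; last by rewrite IH // fgcatU.
by case: v nPP => [[b|y]|[b|y] v] //= _; rewrite fgcatU.
Qed.

Lemma rbmul_catl f g h : rbmul (fgcat f g) h = fgcat f (rbmul g h).
Proof. by apply: freeg_mulA_ext => u v w; rewrite fgcatU !rbmulU wmul_catl. Qed.

Lemma rbmul_catr f g h : rbmul f (fgcat g h) = fgcat (rbmul f g) h.
Proof.
by apply/esym/freeg_mulA_ext => u v w; rewrite fgcatU !rbmulU wmul_catr.
Qed.

Lemma rbmul_Xl a f : rbmul << wsing (LX a) >> f = fgcat << wsing (LX a) >> f.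
Proof.
apply: (freeg_linear_ext (p := rbmul _) (q := fgcat _)) => v /=.
by rewrite rbmulU fgcatU.
Qed.

Lemma rbmul_Xr a f : rbmul f << wsing (LX a) >> = fgcat f << wsing (LX a) >>.
Proof.
apply: (freeg_linear_ext (p := applyr rbmul _) (q := applyr fgcat _)) => u /=.
by rewrite rbmulU fgcatU wmul_noPP // /PP_junction andbF.
Qed.

Lemma rota_baxter_rbmul : rota_baxter lam rbmul fgP.
Proof.
move=> f g.
apply: (freeg_linear_ext (p := applyr rbmul (fgP g) \o fgP)
  (q := fgP \o ((applyr rbmul g \o fgP) \+ applyr rbmul (fgP g)
                  \+ lam \*: applyr rbmul g))) => u /=.
apply: (freeg_linear_ext (p := rbmul (fgP << u >>) \o fgP)
  (q := fgP \o (rbmul (fgP << u >>) \+ (rbmul << u >> \o fgP)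
                  \+ lam \*: rbmul << u >>))) => v /=.
by rewrite !fgPU !rbmulU.
Qed.

Lemma mulA_at_catl f f' g h :
  mulA_at rbmul f' g h -> mulA_at rbmul (fgcat f f') g h.
Proof. by rewrite /mulA_at !rbmul_catl => ->. Qed.

Lemma mulA_at_catm f g g' h : mulA_at rbmul f (fgcat g g') h.
Proof. by rewrite /mulA_at rbmul_catl !rbmul_catr rbmul_catl. Qed.

Lemma mulA_at_catr f g h h' :
  mulA_at rbmul f g h -> mulA_at rbmul f g (fgcat h h').
Proof. by rewrite /mulA_at !rbmul_catr => ->. Qed.

Lemma mulA_at_Xl a g h : mulA_at rbmul << wsing (LX a) >> g h.
Proof. by rewrite /mulA_at !rbmul_Xl rbmul_catl. Qed.

Lemma mulA_at_Xm b f h : mulA_at rbmul f << wsing (LX b) >> h.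
Proof.
by rewrite /mulA_at rbmul_Xl rbmul_Xr rbmul_catl rbmul_catr rbmul_Xl rbmul_Xr fgcatA.
Qed.

Lemma mulA_at_Xr c f g : mulA_at rbmul f g << wsing (LX c) >>.
Proof. by rewrite /mulA_at !rbmul_Xr rbmul_catr. Qed.

Lemma mulA_at_words u v w : mulA_at rbmul << u >> << v >> << w >>.
Proof.
have [n] := ubnP (wsize u + wsize v + wsize w)%N.
elim: n u v w => // n IH u v w lt_n.
case: u lt_n => [a|a u] lt_n; last first.
  rewrite -[wcons a u]/(wcat (wsing a) u) -fgcatU; apply: mulA_at_catl.
  by apply: IH; move: lt_n (lsize_gt0 a) => /=; lia.
case: w lt_n => [c|c w] lt_n; last first.
  rewrite -[wcons c w]/(wcat (wsing c) w) -fgcatU; apply: mulA_at_catr.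
  by apply: IH; move: lt_n (wsize_gt0 w) => /=; lia.
case: v lt_n => [b|b v] lt_n; last first.
  by rewrite -[wcons b v]/(wcat (wsing b) v) -fgcatU; apply: mulA_at_catm.
case: a lt_n => [a|x] lt_n; first exact: mulA_at_Xl.
case: b lt_n => [b|y] lt_n; first exact: mulA_at_Xm.
case: c lt_n => [c|z] lt_n; first exact: mulA_at_Xr.
rewrite -!/(pw _) -!fgPU; apply: (rota_baxter_mulA rota_baxter_rbmul);
  by rewrite ?fgPU; apply: IH; move: lt_n => /=; lia.
Qed.

Lemma rbmulA : associative rbmul.
Proof. by move=> f g h; apply/esym/freeg_mulA_ext/mulA_at_words. Qed.

Definition rb_nf : word X -> M := weval rbmul fgP (fun a => << wsing (LX a) >>).

Lemma rb_nf_id w : rb_word w -> rb_nf w = << w >>.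
Proof.
apply: (@word_mut X
  (fun w => rb_word w -> rb_nf w = << w >>)
  (fun l => rb_letter l -> rb_nf (wsing l) = << wsing l >>)) => //=.
- move=> l IHl u IHu /and3P[/IHl lE /IHu uE nPP].
  by rewrite -[LHS]/(rbmul (rb_nf (wsing l)) (rb_nf u)) lE uE rbmulU wmul_noPP.
- by move=> w' IH /IH w'E; rewrite -[LHS]/(fgP (rb_nf w')) w'E fgPU.
Qed.

End RotaBaxterProduct.

(** * The quotient by the Rota-Baxter ideal *)

Lemma weval_muln_gt0 (A : Type) (h : A -> nat) (w : word A) :
  (forall a, 0 < h a)%N -> (0 < weval muln succn h w)%N.
Proof.
move=> h_gt0.
apply: (@word_mut A (fun w => 0 < weval muln succn h w)%N
                    (fun l => 0 < leval muln succn h l)%N) => //=.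
by move=> l l_gt0 w' w'_gt0; rewrite muln_gt0 l_gt0.
Qed.

Section Weight.
Variables (d : Order.disp_t) (X : orderType d).
Implicit Types (s w x y : word X) (u : word (option X)).

(* With [a = weight x] and [b = weight y], the word [P(x)P(y)] weighs
   [(a + 1)(b + 1)], more than the words [P(P(x)y)], [P(xP(y))] and [P(xy)], which
   weigh [(a + 1)b + 1], [a(b + 1) + 1] and [ab + 1]. *)
Definition weight : word X -> nat := weval muln succn (fun=> 1%N).

Lemma weight_cat w w' : weight (wcat w w') = (weight w * weight w')%N.
Proof. exact: (weval_cat _ mulnA). Qed.

Lemma weight_pw w : weight (pw w) = (weight w).+1.
Proof. by []. Qed.

Lemma weight_gt0 w : (0 < weight w)%N.
Proof. exact: weval_muln_gt0. Qed.

Lemma weight_subst s s' u : (weight s < weight s')%N -> starcount u = 1%N ->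
  (weight (subst s u) < weight (subst s' u))%N.
Proof.
move=> lt_s; rewrite /weight !(weval_subst _ mulnA) -!/(weight _).
set h : X -> nat := fun=> 1%N; pose ev w := weval muln succn (oapp h (weight w)).
have ev_gt0 w v : (0 < ev w v)%N.
  by apply: weval_muln_gt0 => -[a|] //=; apply: weight_gt0.
have ev_cons w l v : ev w (wcons l v) = (ev w (wsing l) * ev w v)%N by [].
have ev_starless v : starcount v = 0%N -> ev s v = ev s' v by exact: weval_starless.
apply: (@word_mut (option X)
  (fun u => starcount u = 1%N -> ev s u < ev s' u)%N
  (fun l => starcount (wsing l) = 1%N -> ev s (wsing l) < ev s' (wsing l))%N) => //.
- move=> l IHl v IHv /eqP; rewrite !ev_cons [starcount _]/= addn_eq1.
  case/orP=> /andP[/eqP star_l /eqP star_v].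
    by rewrite (ev_starless v) // ltn_pmul2r // IHl.
  by rewrite (ev_starless (wsing l)) // ltn_pmul2l // IHv.
- by case.
Qed.

End Weight.

Section Quotient.
Variables (K : comNzRingType) (d : Order.disp_t) (X : orderType d) (lam : K).
Local Notation M := {freeg (word X) / K}.
Implicit Types (f g : opoly K X) (w x y : word X) (u : word (option X)).

(* Up to conversion, [ocoef] is [precoeff] and [psub f g] is [f ++ prefreeg_opp g]. *)
Lemma freeg_psub f g : [freeg psub f g] = [freeg f] - [freeg g] :> M.
Proof.
rewrite /psub freeg_cat; congr (_ + _); apply/eqP/freeg_eqP => w.
by rewrite coeffN !coeff_Freeg -precoeff_opp.
Qed.

Definition rb_ideal : M -> Prop :=
  spanned (fun i : word (option X) * (word X * word X) => starcount i.1 = 1%N)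
          (fun i => [freeg substp i.1 (sRB lam i.2.1 i.2.2)]).

Definition rb_span : M -> Prop := spanned (@rb_word X) (fun w => << w >>).

Lemma inIdP f : inId lam f <-> rb_ideal [freeg f].
Proof.
split=> -[s [star_s eq_f]]; exists s; split=> //.
  apply/eqP/freeg_eqP => w; rewrite coeff_Freeg [LHS]eq_f raddf_sum.
  by apply: eq_bigr => e _; rewrite /= coeffZ coeff_Freeg.
move=> w; rewrite -[LHS]coeff_Freeg eq_f raddf_sum.
by apply: eq_bigr => e _; rewrite /= coeffZ coeff_Freeg.
Qed.

Lemma rb_spanP (D : M) :
  rb_span D <->
  exists2 g : opoly K X, (forall e, e \in g -> rb_word e.2) & D = [freeg g].
Proof.
by split=> [[g [rb_g ->]]|[g rb_g ->]]; exists g; rewrite // freeg_sum.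
Qed.

Lemma rb_span_ideal_submodule : submodule (sum_pred rb_span rb_ideal).
Proof. by apply: sum_pred_submodule; apply: spanned_submodule. Qed.

Lemma freeg_subst_PP u x y :
  << subst (PP x y) u >>
  = << subst (pw (wcat (pw x) y)) u >> + << subst (pw (wcat x (pw y))) u >>
    + lam *: << subst (pw (wcat x y)) u >> + [freeg substp u (sRB lam x y)] :> M.
Proof.
rewrite (freeg_sum (substp u _)) /substp /sRB /= !big_cons big_nil /=.
rewrite !scale1r !scaleN1r scaleNr addr0 -!opprD.
by rewrite [in X in _ = _ + X]addrA [RHS]addrC subrK.
Qed.

Lemma rb_span_ideal_word w : sum_pred rb_span rb_ideal << w >>.
Proof.
have [n] := ubnP (weight w); elim: n w => // n IH w lt_n.
have [rb_w|/not_rb_word_has_PP[u [x [y [u1 eq_w]]]]] := boolP (rb_word w).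
  by apply: sum_predl; [apply: spanned_submodule | apply: spanned_gen].
have span_subst z : (weight z < weight (PP x y))%N ->
    sum_pred rb_span rb_ideal << subst z u >>.
  by move=> lt_z; apply/IH/(leq_trans (weight_subst lt_z u1)); rewrite -eq_w -ltnS.
have ideal_uxy : sum_pred rb_span rb_ideal [freeg substp u (sRB lam x y)].
  apply: sum_predr; first exact: spanned_submodule.
  exact: (spanned_gen _ (i := (u, (x, y)))).
have x_gt0 := weight_gt0 x; have y_gt0 := weight_gt0 y.
have closed := rb_span_ideal_submodule.
rewrite eq_w freeg_subst_PP; apply: (submoduleD closed); last exact: ideal_uxy.
apply: (submoduleD closed); [apply: (submoduleD closed) | apply: (submoduleZ _ closed)];
  by apply: span_subst; rewrite /PP ?(weight_cat, weight_pw); nia.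
Qed.

Lemma rb_span_ideal_full (D : M) : sum_pred rb_span rb_ideal D.
Proof.
apply: spanned_min rb_span_ideal_submodule _ (spanned_freeg D) => w _.
exact: rb_span_ideal_word.
Qed.

Lemma rb_nf_ideal (D : M) : rb_ideal D -> fglift (rb_nf lam) D = 0.
Proof.
apply: (spanned_linear_ext (q := \0)) => -[u [x y]] /= u1; rewrite fglift_Freeg.
exact: (prelift_weval_substp (rota_baxter_rbmul lam) (rbmulA lam) _ _ _ u1).
Qed.

Lemma rb_nf_span (D : M) : rb_span D -> fglift (rb_nf lam) D = D.
Proof.
by apply: (spanned_linear_ext (q := idfun)) => w rb_w /=; rewrite fgliftU rb_nf_id.
Qed.

Lemma rb_span_ideal_disjoint (D : M) : rb_span D -> rb_ideal D -> D = 0.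
Proof. by move=> span_D /rb_nf_ideal; rewrite rb_nf_span. Qed.

End Quotient.

Theorem theorem4p3 (d : Order.disp_t) (X : orderType d) (K : comNzRingType) (lam : K)
  (wfX : well_founded (fun x y : X => (x < y)%O)) :
  (* Irr(S) = Phi(X) *)
  (forall w : word X, Irr lam w <-> Phi w) /\
  (* Phi(X) spans K<X;P>/Id(S) *)
  (forall f : opoly K X, exists g : opoly K X,
      (forall e, e \in g -> Phi e.2) /\ inId lam (psub f g)) /\
  (* Phi(X) is linearly independent modulo Id(S) *)
  (forall g : opoly K X, (forall e, e \in g -> Phi e.2) ->
      inId lam g -> forall w, ocoef g w = 0).
Proof.
split; first by move=> w; rewrite Irr_rb_word Phi_rb_word.
split=> [f|g Phi_g /inIdP ideal_g w].
  have [D [E [/rb_spanP[g rb_g ->] ideal_E f_gE]]] := rb_span_ideal_full lam [freeg f].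
  exists g; split=> [e /rb_g/Phi_rb_word //|]; apply/inIdP.
  by rewrite freeg_psub f_gE addrC addKr.
rewrite -[LHS]coeff_Freeg (rb_span_ideal_disjoint _ ideal_g) ?coeff0 //.
by apply/rb_spanP; exists g => // e /Phi_g/Phi_rb_word.
Qed.
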